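(* Let $(A,\ast)$ be a Jacobi-Jordan algebra, $(V,\rho)$ a representation of it and $\lambda\in\mathbb{K}$. A pair $(\mathcal{I},\mathcal{T})$ of linear maps $\mathcal{I}:A\to A$ and $\mathcal{T}:V\to V$ forms a $\lambda$-weighted Rota-Baxter paired operators if and only if the set $$\mathcal{G}r_{(\mathcal{I},\mathcal{T})}:=\{(\mathcal{I}x,x,\mathcal{T}u,u):x\in A,\ u\in V\}\subset A\oplus A\oplus V\oplus V$$ is a Jacobi-Jordan subalgebra of $(A\oplus A\oplus V\oplus V)_\lambda$.
   Context: $\mathbb{K}$ is a field of characteristic $0$; all vector spaces and linear maps are over $\mathbb{K}$; $gl(V)$ denotes the space of linear endomorphisms of $V$. A Jacobi-Jordan algebra is a vector space $A$ with a bilinear product $\ast$ such that $x\ast y=y\ast x$ and $(x\ast y)\ast z+(y\ast z)\ast x+(z\ast x)\ast y=0$ for all $x,y,z\in A$. A representation of a Jacobi-Jordan algebra $A$ is a vector space $V$ with a linear map $\rho:A\to gl(V)$ such that $\rho(x\ast y)=-\rho(x)\rho(y)-\rho(y)\rho(x)$ for all $x,y\in A$. A pair $(\mathcal{I},\mathcal{T})$ of linear maps $\mathcal{I}:A\to A$, $\mathcal{T}:V\to V$ is called a $\lambda$-weighted Rota-Baxter paired operators if $\mathcal{I}(x)\ast\mathcal{I}(y)=\mathcal{I}(\mathcal{I}x\ast y+x\ast\mathcal{I}y+\lambda(x\ast y))$ for all $x,y\in A$ and $\rho(\mathcal{I}x)\mathcal{T}(u)=\mathcal{T}(\rho(\mathcal{I}x)(u)+\rho(x)\mathcal{T}(u)+\lambda\rho(x)(u))$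 for all $x\in A$, $u\in V$. $(A\oplus A\oplus V\oplus V)_\lambda$ denotes the Jacobi-Jordan algebra with underlying space $A\oplus A\oplus V\oplus V$ and product $$(x,x',u,u')\ltimes(y,y',v,v'):=\big(x\ast y,\ x\ast y'+x'\ast y+\lambda(x'\ast y'),\ \rho(x)v+\rho(y)u,\ \rho(x)v'+\rho(x')v+\lambda\rho(x')v'+\rho(y)u'+\rho(y')u+\lambda\rho(y')u'\big).$$ *)

(* Defs.v *)
From HB Require Import structures.
From mathcomp Require Import all_boot all_algebra.
From mathcomp Require Import boolp classical_sets functions.

Set Implicit Arguments.
Unset Strict Implicit.
Unset Printing Implicit Defensive.

Import GRing.Theory.

Local Open Scope ring_scope.
Local Open Scope classical_set_scope.

Reserved Notation "x ** y" (at level 40, left associativity).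

HB.mixin Record Lmodule_isJacobiJordan (K : fieldType) A of GRing.Lmodule K A := {
  jjmul : A -> A -> A;
  jjmul_bilinear : bilinear_for *:%R *:%R jjmul;
  jjmulC : forall x y, jjmul x y = jjmul y x;
  jjmul_jacobi : forall x y z,
    jjmul (jjmul x y) z + jjmul (jjmul y z) x + jjmul (jjmul z x) y = 0
}.

#[short(type="jacobiJordanType")]
HB.structure Definition JacobiJordan (K : fieldType) :=
  {A of Lmodule_isJacobiJordan K A & GRing.Lmodule K A}.

Notation "x ** y" := (jjmul x y) : ring_scope.

HB.instance Definition _ (K : fieldType) (A : jacobiJordanType K) :=
  bilinear_isBilinear.Build K A A A *:%R *:%R (@jjmul K A) jjmul_bilinear.

(* [rep_linear] is linearity of A -> gl(V), where gl(V) carries the pointwise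
   operations of the function space V -> V. *)
Record jjRep (K : fieldType) (A : jacobiJordanType K) (V : lmodType K) := JJRep {
  rep_map :> A -> {linear V -> V};
  rep_linear : linear (fun x => rep_map x : V -> V);
  rep_jjmul : forall x y v,
    rep_map (x ** y) v = - rep_map x (rep_map y v) - rep_map y (rep_map x v)
}.

Definition rota_baxter_paired (K : fieldType) (A : jacobiJordanType K)
    (V : lmodType K) (rho : jjRep A V) (lam : K)
    (I : {linear A -> A}) (T : {linear V -> V}) : Prop :=
  (forall x y, I x ** I y = I (I x ** y + x ** I y + lam *: (x ** y))) /\
  (forall x u, rho (I x) (T u) =
    T (rho (I x) u + rho x (T u) + lam *: rho x u)).

Arguments rota_baxter_paired {K A V} rho lam I T.

(* [mem S] is the boolean membership predicate of the classical set [S]. *)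
Definition jj_subalgebra (K : fieldType) (B : jacobiJordanType K) (S : set B)
    : Prop :=
  submod_closed (mem S) /\ forall p q, S p -> S q -> S (p ** q).

(* The space A (+) A (+) V (+) V; [rho] and [lam] are phantom parameters on
   which its Jacobi-Jordan structure depends. *)
Definition jj_dsum (K : fieldType) (A : jacobiJordanType K) (V : lmodType K)
    (rho : jjRep A V) (lam : K) : Type := (A * A * V * V)%type.

HB.instance Definition _ (K : fieldType) (A : jacobiJordanType K)
    (V : lmodType K) (rho : jjRep A V) (lam : K) :=
  GRing.Lmodule.copy (jj_dsum rho lam) (A * A * V * V)%type.

Definition dsum_mul (K : fieldType) (A : jacobiJordanType K) (V : lmodType K)
    (rho : jjRep A V) (lam : K) (p q : jj_dsum rho lam) : jj_dsum rho lam :=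
  let: (x, x', u, u') := p in
  let: (y, y', v, v') := q in
  (x ** y,
   x ** y' + x' ** y + lam *: (x' ** y'),
   rho x v + rho y u,
   rho x v' + rho x' v + lam *: rho x' v'
     + rho y u' + rho y' u + lam *: rho y' u').

(* The Jacobi identity of the direct sum is first checked componentwise for
   plain functions [m] and [r], on which rewriting is cheap. *)
Section JacobiComponents.

Variables (K : fieldType) (A V : lmodType K) (lam : K).
Variables (m : A -> A -> A) (r : A -> V -> V).
Hypothesis mDl : forall x y z, m (x + y) z = m x z + m y z.
Hypothesis mZl : forall a x y, m (a *: x) y = a *: m x y.
Hypothesis mJ : forall x y z, m (m x y) z + m (m y z) x + m (m z x) y = 0.
Hypothesis rDl : forall x y v, r (x + y) v = r x v + r y v.
Hypothesis rZl : forall a x v, r (a *: x) v = a *: r x v.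
Hypothesis rDr : forall x u v, r x (u + v) = r x u + r x v.
Hypothesis rZr : forall a x v, r x (a *: v) = a *: r x v.
Hypothesis rM : forall x y v, r (m x y) v = - r x (r y v) - r y (r x v).

Let mJE x y z : m (m x y) z = - m (m y z) x - m (m z x) y.
Proof. by apply/eqP; rewrite -opprD -addr_eq0 addrA mJ. Qed.

Lemma pull_last (M : lmodType K) (b c : M) : b + c = c + b.
Proof. exact: addrC. Qed.

Lemma pull_step (M : lmodType K) (b c s s' : M) :
  s = c + s' -> b + s = c + (b + s').
Proof. by move->; rewrite addrCA. Qed.

Lemma cancel_pos (M : lmodType K) (a s t : M) :
  s = - a + t -> t = 0 -> a + s = 0.
Proof. by move=> -> ->; rewrite addr0 addrN. Qed.

Lemma cancel_neg (M : lmodType K) (a s t : M) :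
  s = a + t -> t = 0 -> - a + s = 0.
Proof. by move=> -> ->; rewrite addr0 addNr. Qed.

Local Ltac pull := match goal with
  | |- ?c + ?s = ?c + _ => reflexivity
  | |- ?b + ?c = ?c + _ => apply: pull_last
  | |- ?b + ?s = ?c + _ => apply: pull_step; pull
  end.

(* Proves that a sum of pairwise opposite terms is zero. *)
Local Ltac sum_cancel := rewrite ?opprD -?addrA;
  repeat match goal with
  | |- context [- (?a *: ?x)] => move: (a *: x) => ?
  end;
  repeat match goal with
  | |- - ?a + ?a = 0 => exact: addNr
  | |- ?a - ?a = 0 => exact: addrN
  | |- - ?a + ?s = 0 => apply: cancel_neg; [pull|]
  | |- ?a + ?s = 0 => apply: cancel_pos; [pull|]
  end.

Lemma jacobi_component2 x x' y y' z z' :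
  let n a a' b b' := m a b' + m a' b + lam *: m a' b' in
  n (m x y) (n x x' y y') z z' + n (m y z) (n y y' z z') x x'
    + n (m z x) (n z z' x x') y y' = 0.
Proof.
rewrite /= ?mDl ?mZl.
rewrite (mJE x y z') (mJE x y' z) (mJE x' y z) (mJE x y' z').
rewrite (mJE x' y z') (mJE x' y' z) (mJE x' y' z').
rewrite ?scalerDr ?scalerN.
by sum_cancel.
Qed.

Lemma jacobi_component3 x y z u v w :
  r (m x y) w + r z (r x v + r y u) + (r (m y z) u + r x (r y w + r z v))
    + (r (m z x) v + r y (r z u + r x w)) = 0.
Proof. by rewrite ?rDr !rM; sum_cancel. Qed.

Lemma jacobi_component4 x x' y y' z z' u u' v v' w w' :
  let n a a' b b' := m a b' + m a' b + lam *: m a' b' in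
  let s a a' c c' b b' d d' := r a d' + r a' d + lam *: r a' d'
    + r b c' + r b' c + lam *: r b' c' in
  s (m x y) (n x x' y y') (r x v + r y u) (s x x' u u' y y' v v') z z' w w'
  + s (m y z) (n y y' z z') (r y w + r z v) (s y y' v v' z z' w w') x x' u u'
  + s (m z x) (n z z' x x') (r z u + r x w) (s z z' w w' x x' u u') y y' v v'
  = 0.
Proof.
rewrite /= ?(rDl, rZl).
rewrite ?(rDr, rZr) !rM.
rewrite ?scalerDr ?scalerN.
by sum_cancel.
Qed.

End JacobiComponents.

Section DirectSumTheory.

Variables (K : fieldType) (A : jacobiJordanType K) (V : lmodType K).
Variables (rho : jjRep A V) (lam : K).

Lemma rep_linearE a x y v : rho (a *: x + y) v = a *: rho x v + rho y v.
Proof. exact: (congr1 (@^~ v) (rep_linear rho a x y)). Qed.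

Lemma rep_addl x y v : rho (x + y) v = rho x v + rho y v.
Proof. by rewrite -[x in LHS]scale1r rep_linearE scale1r. Qed.

Lemma rep_scalel a x v : rho (a *: x) v = a *: rho x v.
Proof.
have rho0 : rho 0 v = 0.
  by apply: (@addrI _ (rho 0 v)); rewrite -rep_addl !addr0.
by rewrite -[a *: x]addr0 rep_linearE rho0 addr0.
Qed.

Lemma rep_addr x u v : rho x (u + v) = rho x u + rho x v.
Proof. exact: linearD. Qed.

Lemma rep_scaler a x v : rho x (a *: v) = a *: rho x v.
Proof. exact: linearZ. Qed.

Lemma jjmul_scalel a (x y : A) : (a *: x) ** y = a *: (x ** y).
Proof. exact: linearZl_LR. Qed.

Lemma jjmul_addl (x y z : A) : (x + y) ** z = x ** z + y ** z.
Proof. exact: linearDl. Qed.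

Local Ltac to_front a :=
  repeat match goal with
  | |- _ = a + _ => fail 1
  | |- _ = a => fail 1
  | |- _ => first [rewrite [in RHS](addrCA _ a) | rewrite [in RHS](addrC _ a)]
  end.

(* Equality of sums up to associativity and commutativity. *)
Local Ltac sum_ac := rewrite -?addrA;
  repeat match goal with
  | |- ?a = ?a => reflexivity
  | |- ?a + _ = _ => to_front a; congr (_ + _)
  end.

Local Ltac expand := rewrite ?(jjmul_addl, jjmul_scalel,
  rep_addl, rep_scalel, rep_addr, rep_scaler, scalerDr, scalerA).

Lemma dsum_mulC (p q : jj_dsum rho lam) : dsum_mul p q = dsum_mul q p.
Proof.
case: p q => [[[x x'] u] u'] [[[y y'] v] v'] /=.
congr (_, _, _, _).
- exact: jjmulC.
- by rewrite (jjmulC x y') (jjmulC x' y) (jjmulC x' y') [y' ** x + _]addrC.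
- exact: addrC.
- sum_ac.
Qed.

Lemma dsum_addE x x' u u' y y' v v' :
  (x, x', u, u') + (y, y', v, v') = (x + y, x' + y', u + v, u' + v')
    :> jj_dsum rho lam.
Proof. by []. Qed.

Lemma dsum_scaleE a x x' u u' :
  a *: (x, x', u, u') = (a *: x, a *: x', a *: u, a *: u') :> jj_dsum rho lam.
Proof. by []. Qed.

Lemma dsum_mul_linearl (q : jj_dsum rho lam) :
  linear (fun p : jj_dsum rho lam => dsum_mul p q).
Proof.
case: q => [[[y y'] v] v'] a [[[x1 x1'] u1] u1'] [[[x2 x2'] u2] u2'].
rewrite /dsum_mul !(dsum_scaleE, dsum_addE); congr (_, _, _, _).
- by expand.
- by expand; rewrite ?(mulrC lam a); sum_ac.
- by expand; sum_ac.
- by expand; rewrite ?(mulrC lam a); sum_ac.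
Qed.

Lemma dsum_mul_bilinear : bilinear_for *:%R *:%R (@dsum_mul K A V rho lam).
Proof.
split=> p a q r; first exact: dsum_mul_linearl.
by rewrite !(dsum_mulC p); exact: dsum_mul_linearl.
Qed.

Lemma dsum_mul_jacobi (p q r : jj_dsum rho lam) :
  dsum_mul (dsum_mul p q) r + dsum_mul (dsum_mul q r) p
    + dsum_mul (dsum_mul r p) q = 0.
Proof.
case: p q r => [[[x x'] u] u'] [[[y y'] v] v'] [[[z z'] w] w'].
rewrite /dsum_mul !dsum_addE -[0]/(0, 0, 0, 0); congr (_, _, _, _).
- exact: jjmul_jacobi.
- exact: (jacobi_component2 lam jjmul_addl jjmul_scalel jjmul_jacobi).
- exact: (jacobi_component3 rep_addr (@rep_jjmul _ _ _ rho)).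
- exact: (jacobi_component4 lam rep_addl rep_scalel rep_addr rep_scaler
    (@rep_jjmul _ _ _ rho)).
Qed.

End DirectSumTheory.

HB.instance Definition _ (K : fieldType) (A : jacobiJordanType K)
    (V : lmodType K) (rho : jjRep A V) (lam : K) :=
  Lmodule_isJacobiJordan.Build K (jj_dsum rho lam)
    (dsum_mul_bilinear rho lam) (@dsum_mulC K A V rho lam)
    (@dsum_mul_jacobi K A V rho lam).

Definition graph_pair (K : fieldType) (A : jacobiJordanType K)
    (V : lmodType K) (rho : jjRep A V) (lam : K)
    (I : {linear A -> A}) (T : {linear V -> V}) : set (jj_dsum rho lam) :=
  [set p | exists (x : A) (u : V), p = (I x, x, T u, u)].

Arguments graph_pair {K A V} rho lam I T.

(* Main.v *)
Require Import Defs.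
From HB Require Import structures.
From mathcomp Require Import all_boot all_algebra.
From mathcomp Require Import boolp classical_sets functions.

Set Implicit Arguments.
Unset Strict Implicit.
Unset Printing Implicit Defensive.

Import GRing.Theory.

Local Open Scope ring_scope.

(** The product of two graph elements (I x, x, T u, u) and (I y, y, T v, v) is
    (I x ** I y,
     I x ** y + x ** I y + lam (x ** y),
     rho (I x) (T v) + rho (I y) (T u),
     W x v + W y u),
    where W x u = rho (I x) u + rho x (T u) + lam (rho x u).  It lies in the
    graph exactly when I sends its second entry to the first one and T sends
    its fourth entry to the third one.  The first condition is the Rota-Baxter
    identity for I; the second is the identity for T, summed over the pairs
    (x, v) and (y, u), so that taking y = 0 and u = 0 isolates a single
    instance ([graph_mulP]).  Being a linear subspace is no constraint, since I
    and T are linear ([graph_submod_closed]). *)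

Section Graph.

Variables (K : fieldType) (A : jacobiJordanType K) (V : lmodType K).
Variables (rho : jjRep A V) (lam : K).
Variables (I : {linear A -> A}) (T : {linear V -> V}).

Lemma graph_pairE x x' u u' :
  graph_pair rho lam I T (x, x', u, u') <-> x = I x' /\ u = T u'.
Proof.
split=> [[y [v [-> -> -> ->]]] // | [-> ->]].
by exists x', u'.
Qed.

Lemma graph_submod_closed : submod_closed (mem (graph_pair rho lam I T)).
Proof.
split; first by rewrite in_setE; apply/graph_pairE; rewrite !linear0.
move=> a p q; rewrite !in_setE => -[x [u ->]] [y [v ->]].
by rewrite dsum_scaleE dsum_addE; apply/graph_pairE; rewrite !linearP.
Qed.

(** The V-condition is stated with T distributed over the two halves of its
    argument, so that it reads as the sum of two instances of the Rota-Baxter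
    identity for T and each can be rewritten, or made to vanish, separately. *)
Lemma graph_mulP x y u v :
  graph_pair rho lam I T
    (((I x, x, T u, u) : jj_dsum rho lam) ** (I y, y, T v, v)) <->
  I x ** I y = I (I x ** y + x ** I y + lam *: (x ** y)) /\
  rho (I x) (T v) + rho (I y) (T u) =
    T (rho (I x) v + rho x (T v) + lam *: rho x v) +
    T (rho (I y) u + rho y (T u) + lam *: rho y u).
Proof. by rewrite -(linearD T) !addrA; exact: graph_pairE. Qed.

End Graph.

Theorem proposition3p6 (K : fieldType) (charK : [pchar K] =i pred0)
    (A : jacobiJordanType K) (V : lmodType K) (rho : jjRep A V) (lam : K)
    (I : {linear A -> A}) (T : {linear V -> V}) :
  rota_baxter_paired rho lam I T <-> jj_subalgebra (graph_pair rho lam I T).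
Proof.
split=> [[RB_I RB_T] | [_ graphM]].
  split; first exact: graph_submod_closed.
  move=> _ _ [x [u ->]] [y [v ->]].
  by apply/graph_mulP; split; [exact: RB_I | rewrite !RB_T].
have graph_xu x u : graph_pair rho lam I T (I x, x, T u, u) by exists x, u.
split=> [x y | x u].
  by have /graph_mulP[] := graphM _ _ (graph_xu x 0) (graph_xu y 0).
have /graph_mulP[_] := graphM _ _ (graph_xu x 0) (graph_xu 0 u).
by rewrite !linear0 !addr0 linear0 addr0.
Qed.
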